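(* For every $n\in\mathbb{N}$, $n\ge1$, the variance of $G_n$ is given by $$\mathbb{V}[G_n]=2n-\mathbb{E}[G_n]-\mathbb{E}[G_n]^2.$$
   Context: Let $X_1,X_2,\ldots$ be independent random variables, each uniformly distributed on $\{1,2,\ldots,n\}$. The gain is $G_n=\min\{k\in\{1,\ldots,n\}: X_k\le k\}$ (well defined since $X_n\le n$). Its probability mass function is $p_{k,n}=\mathbb{P}(G_n=k)=\frac{k}{n^k}\cdot\frac{(n-1)!}{(n-k)!}$ for $1\le k\le n$. Here $\mathbb{E}$ denotes expectation and $\mathbb{V}[G_n]=\mathbb{E}[G_n^2]-\mathbb{E}[G_n]^2$. *)

(* Defs.v *)
From mathcomp Require Import all_boot all_order all_algebra.
From mathcomp Require Import all_classical all_reals all_analysis.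

Set Implicit Arguments.
Unset Strict Implicit.
Unset Printing Implicit Defensive.

Import Order.TTheory GRing.Theory Num.Theory.

Local Open Scope classical_set_scope.
Local Open Scope ring_scope.

(* Mutual independence of the subfamily (X i)_{i in D}: the product rule holds
   for every finite set of distinct indices taken in D. *)
Definition mutually_independent {d d' : measure_display}
    {T : measurableType d} {T' : measurableType d'} {R : realType}
    (P : probability T R) {I : choiceType} (D : set I)
    (X : I -> {RV P >-> T'}) : Prop :=
  forall (s : seq I) (A : I -> set T'),
    uniq s -> (forall i, i \in s -> D i) ->
    (forall i, i \in s -> measurable (A i)) ->
    P (\bigcap_(i in [set` s]) (X i @^-1` A i)) =
      (\prod_(i <- s) P (X i @^-1` A i))%E.

(* Only the law is prescribed, so X takes values in {1, ..., n} almost surely. *)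
Definition uniform_1n {d : measure_display} {T : measurableType d}
    {R : realType} (P : probability T R) (n : nat) (X : {RV P >-> nat}) : Prop :=
  forall j : nat, distribution P X [set j] =
    (if (1 <= j <= n)%N then n%:R^-1 else 0)%:E.

(* min {k in {1, ..., n} : x k <= k}; since every such k is at most n, taking n
   as the neutral element of the minimum does not change its value. If the set
   is empty (which requires n < x n, hence has probability 0) the value is n. *)
Definition gain (n : nat) (x : nat -> nat) : nat :=
  \big[minn/n]_(1 <= k < n.+1 | (x k <= k)%N) k.

(* Main.v *)
(* Write s_k = P(G > k) = prod_(1 <= j <= k) (n - j)/n. Summing over k < G gives
   E[G^2 + G] = sum_(k < n) 2(k + 1) s_k. Since s_(k+1) = s_k (n - k - 1)/n, each
   term is 2n (s_k - s_(k+1)), so the sum telescopes to 2n (s_0 - s_n) = 2n. *)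

Require Import Defs.
From mathcomp Require Import all_boot all_order all_algebra.
From mathcomp Require Import all_classical all_reals all_analysis.
From mathcomp Require Import zify ring.

Import Order.TTheory GRing.Theory Num.Theory.
Local Open Scope classical_set_scope.
Local Open Scope ring_scope.

Lemma ltn_bigmin (s : seq nat) (Q : pred nat) (n k : nat) :
  (k < \big[minn/n]_(i <- s | Q i) i)%N =
  (k < n)%N && all (fun i => Q i ==> (k < i)%N) s.
Proof.
elim: s => [|a s IHs]; first by rewrite big_nil andbT.
rewrite big_cons /=; case: (Q a) => //=.
by rewrite leq_min IHs andbCA.
Qed.

Lemma gain_le (n : nat) (x : nat -> nat) : (gain n x <= n)%N.
Proof. by rewrite leqNgt /gain ltn_bigmin ltnn. Qed.

(** Only the indices up to [k] matter: a later index satisfying [x j <= j] cannot bring the minimum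
    down to [k]. The bound [k < n] keeps the neutral element [n] from deciding the comparison. *)
Lemma ltn_gain (n : nat) (x : nat -> nat) (k : nat) : (k < n)%N ->
  (k < gain n x)%N = all (fun j => (j < x j)%N) (iota 1 k).
Proof.
move=> kn; rewrite /gain ltn_bigmin kn /= /index_iota subn1 /=.
apply/allP/allP => h j; rewrite mem_iota => /andP[j1 jk].
  rewrite ltnNge; apply/negP => xj.
  have jn : j \in iota 1 n by rewrite mem_iota; lia.
  by have /implyP/(_ xj) := h j jn; lia.
apply/implyP => xj; rewrite ltnNge; apply/negP => kj.
have jk' : j \in iota 1 k by rewrite mem_iota; lia.
by have := h j jk'; lia.
Qed.

(** Trades a range of random length for a fixed range weighted by indicators, so that expectations
    can be taken term by term. *)
Lemma sum_ltn_weighted (n g : nat) (w : nat -> nat) : (g <= n)%N ->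
  (\sum_(k < n) w k * (k < g) = \sum_(k < g) w k)%N.
Proof.
move=> gn; rewrite (big_ord_widen n w gn) [RHS]big_mkcond /=.
by apply: eq_bigr => k _; case: ltnP; rewrite (muln1, muln0).
Qed.

Lemma sum_double_succ (g : nat) : (\sum_(k < g) 2 * k.+1 = g ^ 2 + g)%N.
Proof. by elim: g => [|g IHg]; rewrite ?big_ord0// big_ord_recr /= IHg; lia. Qed.

(** Since the law is given by its point masses, the tail is computed through its finite complement,
    the disjoint union of the points 0, ..., [j]. *)
Lemma uniform_1n_gt {R : realType} {d : measure_display}
    {T : measurableType d} {P : probability T R} {n : nat}
    (Y : {RV P >-> nat}) (j : nat) :
  (0 < n)%N -> (j <= n)%N -> uniform_1n n Y ->
  P (Y @^-1` [set m | (j < m)%N]) = ((n - j)%:R / n%:R)%:E.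
Proof.
move=> n0 jn unifY.
rewrite -[P _]/(distribution P Y [set m | (j < m)%N]).
have -> : [set m | (j < m)%N] = ~` (\big[setU/set0]_(i < j.+1) [set (i : nat)]).
  rewrite -bigcup_mkord; apply/seteqP; split => m /=.
    by move=> jm [i /= ij mi]; move: jm; rewrite mi; lia.
  by move=> h; rewrite ltnNge; apply/negP => mj; apply: h; exists m.
rewrite probability_setC; last exact: bigsetU_measurable.
rewrite measure_bigsetU_ord//; last first.
  apply/trivIsetP => a b _ _ ab; apply/seteqP; split => // m [/= ->].
  by move=> /val_inj /eqP; rewrite (negPf ab).
rewrite (eq_bigr (fun i : 'I_j.+1 =>
  (if (1 <= i <= n)%N then n%:R^-1 else 0)%:E)) => [|i _]; last exact: unifY.
rewrite sumEFin -EFinB; congr _%:E.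
(* The point 0 has mass 0; each of the [j] others has mass 1/n because [j <= n]. *)
rewrite big_ord_recl /= add0r.
rewrite (eq_bigr (fun=> n%:R^-1)) => [|i _]; last first.
  by rewrite ifT//= /bump; have := ltn_ord i; lia.
rewrite sumr_const card_ord natrB// mulrBl divff ?mulr_natl//.
by rewrite pnatr_eq0; lia.
Qed.

(** An indicator equals its own square, so the integral to bound is P(A) <= 1. *)
Lemma indic_Lfun2 {R : realType} {d : measure_display} {T : measurableType d}
    (P : probability T R) (A : set T) :
  measurable A -> (\1_A : T -> R) \in Lfun P 2%:E.
Proof.
move=> mA; rewrite inE; apply/andP; split; rewrite inE//=.
rewrite /finite_norm unlock poweR_lty//.
under eq_integral => x _ /=.
  rewrite (_ : (`|\1_A x| `^ 2 = \1_A x :> R)%R); last first.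
    by rewrite indicE; case: (x \in A); rewrite ?normr1 ?powR1 ?normr0 ?powR0.
  over.
by rewrite integral_indic// setIT (le_lt_trans (probability_le1 P mA)) ?ltry.
Qed.

Lemma prod_survival_telescope {R : realType} (n : nat) : (0 < n)%N ->
  (\sum_(k < n) (2 * k.+1)%:R * \prod_(j <- iota 1 k) ((n - j)%:R / n%:R) =
   (2 * n)%:R :> R)%R.
Proof.
move=> n0; pose s k : R := \prod_(j <- iota 1 k) ((n - j)%:R / n%:R).
have n0' : n%:R != 0 :> R by rewrite pnatr_eq0; lia.
have sS k : s k.+1 = s k * ((n - k.+1)%:R / n%:R).
  by rewrite /s -{1}(addn1 k) iotaD big_cat /= big_seq1 add1n.
(* The last factor, at j = n, is (n - n)/n. *)
have s_n : s n = 0.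
  by case: (n) n0 sS => // m _ ->; rewrite subnn mul0r mulr0.
rewrite (eq_bigr (fun k : 'I_n => (2 * n)%:R * (s k - s k.+1))) => [|k _].
  rewrite -mulr_sumr -(big_mkord xpredT (fun k => s k - s k.+1)).
  rewrite -[X in _ * X]opprK -sumrN.
  under eq_bigr do rewrite opprB.
  by rewrite telescope_sumr// s_n /s big_nil; ring.
rewrite sS -/(s k) natrB; last exact: ltn_ord.
by rewrite !natrM; field.
Qed.

Theorem proposition5p1 (R : realType) (d : measure_display)
    (T : measurableType d) (P : probability T R) (n : nat) (n_ge1 : (1 <= n)%N)
    (X : nat -> {RV P >-> nat})
    (X_indep : mutually_independent [set k | (1 <= k)%N] X)
    (X_unif : forall k : nat, (1 <= k)%N -> uniform_1n n (X k)) :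
  let G : T -> R := fun t => (gain n (fun k => X k t))%:R in
  'V_P[G] = ((2 * n)%:R%:E - 'E_P[G] - 'E_P[G] ^+ 2)%E.
Proof.
move=> G.
pose g t := gain n (fun k => X k t).
(* For [k < n] this is the event G > k, written as an intersection so that independence applies
   directly. *)
pose A k : set T := \bigcap_(j in [set` iota 1 k]) (X j @^-1` [set m | (j < m)%N]).
have mA k : measurable (A k).
  by apply: fin_bigcap_measurable => // j _; exact: measurable_funPTI.
have PA k : (k < n)%N -> P (A k) = (\prod_(j <- iota 1 k) ((n - j)%:R / n%:R))%:E.
  move=> kn; rewrite /A X_indep ?iota_uniq//; last first.
    by move=> i /=; rewrite mem_iota => /andP[].
  rewrite -prodEFin; apply: eq_big_seq => j; rewrite mem_iota => /andP[j1 jk].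
  by apply: uniform_1n_gt => //; [lia|exact: X_unif].
have indA k t : (k < n)%N -> \1_(A k) t = (k < g t)%N%:R :> R.
  move=> kn; rewrite indicE ltn_gain//; congr (nat_of_bool _)%:R.
  apply/idP/allP => [/set_mem h j|h]; first exact: h.
  by apply/mem_set => j; exact: h.
have wsum (w : nat -> nat) t : \sum_(k < n) (w k)%:R * \1_(A k) t =
    (\sum_(k < g t) w k)%N%:R :> R.
  rewrite -(@sum_ltn_weighted n (g t) w) ?gain_le// natr_sum.
  by apply: eq_bigr => k _; rewrite indA// natrM.
(* With weight 1, [wsum] writes G as a finite sum of indicators, from which its measurability and
   square integrability follow. *)
have GE : G = \sum_(k < n) \1_(A k).
  apply/funext => t; rewrite fct_sumE /=.
  have := wsum (fun=> 1%N) t; rewrite sum1_card card_ord => gE.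
  by rewrite -[LHS]gE; apply: eq_bigr => k _; rewrite mul1r.
have G2 : G \in Lfun P 2%:E.
  by rewrite GE rpred_sum ?lee1n// => ? k _; exact: indic_Lfun2.
have G1 : G \in Lfun P 1 by apply: Lfun_subset12 G2; exact: fin_num_measure.
have GG1 : G ^+ 2 \in Lfun P 1 by exact: Lfun2_mul_Lfun1.
have E2 : ('E_P[G ^+ 2] + 'E_P[G] = (2 * n)%:R%:E)%E.
  (* The weights 2(k + 1) are chosen because their sum over k < g is g^2 + g. *)
  pose W k : T -> R := (2 * k.+1)%:R \o* \1_(A k).
  have indA1 k : (\1_(A k) : T -> R) \in Lfun P 1.
    by apply: Lfun_subset12; [exact: fin_num_measure|exact: indic_Lfun2].
  rewrite -expectationD//.
  have -> : G ^+ 2 \+ G = \sum_(Wk <- [seq W k | k <- index_iota 0 n]) Wk.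
    apply/funext => t; rewrite big_map big_mkord fct_sumE /=.
    under eq_bigr do rewrite /W /= mulrC.
    by rewrite (wsum (fun k => 2 * k.+1)%N) sum_double_succ natrD natrX.
  rewrite expectation_sum => [|_ /mapP[k _ ->]]; last exact: Lfun_scale.
  rewrite big_map big_mkord.
  rewrite -(@prod_survival_telescope R n)// -sumEFin; apply: eq_bigr => k _.
  by rewrite /W expectationZl// expectation_indic// PA.
(* Replacing 2n by E[G^2] + E[G] leaves E[G] to cancel, which in the extended reals requires it to
   be finite. *)
rewrite varianceE// -E2 addeK//; exact: expectation_fin_num.
Qed.
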